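(* Consider the problem $\min_{y\in\mathbb{R}^n}\phi(y):=f(y)+h(y)$ under the standing assumptions given in the context. Given a tolerance $\epsilon>0$, Algorithm mFISTA (described in the context) outputs an $\epsilon$-approximate solution of this problem in at most $\mathcal{O}(\epsilon^{-2})$ iterations. In the case when $f$ is convex on $\Omega$, the iteration complexity becomes $\mathcal{O}(\epsilon^{-2/3})$, i.e. Algorithm mFISTA outputs an $\epsilon$-approximate solution in at most $\mathcal{O}(\epsilon^{-2/3})$ iterations.
   Context: **Problem and standing assumptions.** $\Omega\subseteq\mathbb{R}^n$ is a closed convex set. $f$ is a real-valued function on $\mathbb{R}^n$, possibly nonconvex on $\Omega$, differentiable with $\|\nabla f(u_1)-\nabla f(u_2)\|\le L\|u_1-u_2\|$ for all $u_1,u_2\in\Omega$, where $L>0$. $h:\mathbb{R}^n\to(-\infty,+\infty]$ is a proper lower semicontinuous convex function (possibly nonsmooth) with $\mathrm{dom}\,h$ closed and bounded, $\mathrm{dom}\,h\subseteq\Omega$, and $\|y\|\le C$ for all $y\in\mathrm{dom}\,h$, where $C>0$ is a constant. $P_\Omega$ denotes the Euclidean projection onto $\Omega$, and $\partial h$ the convex subdifferential. For a differentiable $g$, write $l_g(u_1;u_2):=g(u_2)+\langle\nabla g(u_2),u_1-u_2\rangle$. **$\epsilon$-approximate solution.** A pair $(y,v)$ with $v\in\nabla f(y)+\partial h(y)$ and $\|v\|\le\epsilon$. **Algorithm mFISTA.** Input: $\epsilon>0$, an initial point $x_1=y_0\in\mathrm{dom}\,h$, $a_0=1$, $L_1=0$.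 For $k=1,2,\dots$: 1. Set $f_k(y)=f(y)+\frac{L_k}{2}\|y-y_{k-1}\|^2$. 2. Compute $y_k=\operatorname{argmin}_{y\in\mathbb{R}^n}\{l_{f_k}(y;x_k)+h(y)+2L\|y-x_k\|^2\}$. 3. Find $a_k>0$ with $a_k(a_k-1)=a_{k-1}^2$. 4. Compute $v_k=\nabla f(y_k)-\nabla f(x_k)+L_k[y_{k-1}-x_k]+4L[x_k-y_k]$ and $x_{k+1}=P_\Omega\left(y_k+\frac{a_{k-1}-1}{a_k}(y_k-y_{k-1})\right)$. 5. Set $A_k=\frac{2(l_f(y_k;x_{k+1})-f(y_k))}{\|y_k-x_{k+1}\|^2}$ if $y_k\neq x_{k+1}$ and $A_k=0$ otherwise; set $L_{k+1}=\max\{0,A_k\}$. Termination: the algorithm exits at the first $k$ with $\|v_k\|\le\epsilon$ and outputs $(y_k,v_k)$; this $k$ is the number of iterations $N(\epsilon)$. **Meaning of $\mathcal{O}$.** For fixed problem data and initial point, ''at most $\mathcal{O}(\epsilon^{-p})$ iterations'' means: for every $\epsilon_0>0$ there is a constant $M>0$ independent of $\epsilon$ such that $N(\epsilon)$ is finite and $N(\epsilon)\le M\epsilon^{-p}$ for all $\epsilon\in(0,\epsilon_0]$. *)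

(* Defs.v *)
From HB Require Import structures.
From mathcomp Require Import all_boot all_order all_algebra.
From mathcomp Require Import all_classical all_reals all_analysis.

Set Implicit Arguments.
Unset Strict Implicit.
Unset Printing Implicit Defensive.

Import Order.TTheory GRing.Theory Num.Theory.
Import numFieldNormedType.Exports.

Local Open Scope classical_set_scope.
Local Open Scope ring_scope.

Section Euclidean.
Context {R : realType} {n : nat}.
Implicit Types (u w x : 'rV[R]_n) (Omega : set 'rV[R]_n) (g : 'rV[R]_n -> R).

Definition dot u w : R := \sum_(i < n) u 0 i * w 0 i.

(* MathComp-Analysis norms ['rV[R]_n] by the sup norm; this is the Euclidean
   norm, and the two define the same topology and the same bounded sets. *)
Definition enorm u : R := Num.sqrt (dot u u).

(* The vector of partial derivatives; it represents the differential of [g]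
   at [x] with respect to [dot] only where [g] is differentiable. *)
Definition gradient g x : 'rV[R]_n := \row_(i < n) 'D_(delta_mx 0 i) g x.

Definition linearization g u1 u2 : R := g u2 + dot (gradient g u2) (u1 - u2).

Definition is_projection Omega x p :=
  Omega p /\ forall z, Omega z -> enorm (x - p) <= enorm (x - z).

End Euclidean.

Section ExtendedValued.
Context {R : realType} {n : nat}.
Implicit Types (h : 'rV[R]_n -> \bar R) (y s : 'rV[R]_n).
Local Open Scope ereal_scope.

Definition edom h : set 'rV[R]_n := [set y | h y < +oo].

Definition proper_efun h := (forall y, -oo < h y) /\ edom h !=set0.

(* Since [0 * +oo = 0] in [\bar R], the cases [t = 0] and [t = 1] are trivial;
   for [h > -oo] the right-hand side never has the form [+oo - oo]. *)
Definition convex_efun h := forall (y1 y2 : 'rV[R]_n) (t : R),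
  (0 <= t <= 1)%R ->
  h (t *: y1 + (1 - t) *: y2)%R <= t%:E * h y1 + (1 - t)%:E * h y2.

Definition subdifferential h y : set 'rV[R]_n :=
  [set s | forall u, h y + (dot s (u - y))%:E <= h u].

Definition argmin h : set 'rV[R]_n := [set y | forall u, h y <= h u].

End ExtendedValued.

Section MFISTA.
Context {R : realType} {n : nat}.

Definition approx_solution (f : 'rV[R]_n -> R) (h : 'rV[R]_n -> \bar R)
    (eps : R) (y v : 'rV[R]_n) :=
  [set gradient f y + s | s in subdifferential h y] v /\ enorm v <= eps.

(* The entries [iter_x 0], [iter_v 0], [iter_L 0] and [iter_A 0] are junk: the
   algorithm never uses them and [mFISTA_run] leaves them unconstrained. *)
Record iterates := Iterates {
  iter_x : nat -> 'rV[R]_n;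
  iter_y : nat -> 'rV[R]_n;
  iter_v : nat -> 'rV[R]_n;
  iter_a : nat -> R;
  iter_L : nat -> R;
  iter_A : nat -> R }.

(* The stopping test is not part of the recursion: the iterates do not depend
   on the tolerance, which only decides where the sequence is cut. *)
Definition mFISTA_run (f : 'rV[R]_n -> R) (h : 'rV[R]_n -> \bar R)
    (Omega : set 'rV[R]_n) (L : R) (y0 : 'rV[R]_n) (S : iterates) :=
  let x := iter_x S in let y := iter_y S in let v := iter_v S in
  let a := iter_a S in let Lk := iter_L S in let A := iter_A S in
  [/\ x 1%N = y0, y 0%N = y0, a 0%N = 1, Lk 1%N = 0 &
   forall k, (0 < k)%N ->
   let fk := fun z => f z + Lk k / 2 * enorm (z - y k.-1) ^+ 2 in
   [/\ y k \in argmin (fun z =>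
         (linearization fk z (x k))%:E + h z
           + (2 * L * enorm (z - x k) ^+ 2)%:E)%E,
       0 < a k /\ a k * (a k - 1) = a k.-1 ^+ 2,
       v k = gradient f (y k) - gradient f (x k)
             + Lk k *: (y k.-1 - x k) + (4 * L) *: (x k - y k),
       is_projection Omega
         (y k + ((a k.-1 - 1) / a k) *: (y k - y k.-1)) (x k.+1) &
       A k = (if y k == x k.+1 then 0 else
                2 * (linearization f (y k) (x k.+1) - f (y k))
                  / enorm (y k - x k.+1) ^+ 2)
       /\ Lk k.+1 = Num.max 0 (A k)]].

Definition terminates_at (S : iterates) (eps : R) (N : nat) :=
  [/\ (0 < N)%N, enorm (iter_v S N) <= eps &
      forall k, (0 < k < N)%N -> eps < enorm (iter_v S k)].

Definition mFISTA_complexity (f : 'rV[R]_n -> R) (h : 'rV[R]_n -> \bar R)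
    (Omega : set 'rV[R]_n) (L : R) (y0 : 'rV[R]_n) (p : R) :=
  forall eps0 : R, 0 < eps0 ->
  exists2 M : R, 0 < M &
  forall eps : R, 0 < eps <= eps0 ->
  forall S : iterates, mFISTA_run f h Omega L y0 S ->
  exists N : nat,
    [/\ terminates_at S eps N,
        approx_solution f h eps (iter_y S N) (iter_v S N) &
        N%:R <= M * eps `^ (- p)].

End MFISTA.

Arguments iterates : clear implicits.

(* Main.v *)
(* One iteration of FISTA for the model [f + L_k/2 |. - y_(k-1)|^2], tested
   against [u = (1 - 1/a) y_(k-1) + z/a] with [z] in [edom h] and [a = a_(k-1)],
   gives, for [F = f + h] and the FISTA auxiliary sequence [w],
     a^2 (F y_k - F z) + a^2 r_k + 2 L |z - w_k|^2
       <= a (a - 1) (F y_(k-1) - F z) + a D + 2 L |z - w_(k-1)|^2,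
   where [r_k = L |y_k - x_k|^2 + L_k/2 |y_k - y_(k-1)|^2]; the choice of [L_k]
   is what makes the linearized model at [x_k] lie below [f] at [y_(k-1)]. The
   error [D] measures the failure of the tangent inequality of [f] at [z]:
   [D = 10 L C^2] always works, and [D = 0] works when [f] is convex, since then
   [L_k = 0]. As [a_k (a_k - 1) = a_(k-1)^2], these inequalities telescope, and
   taking [z] to be the last iterate removes the function gap, so that no
   minimizer of [F] is needed. Since [|v_k|^2 <= 72 L r_k], if [|v_k| > eps] for
   all [1 <= k <= K] then
     eps^2 (a_0^2 + ... + a_(K-1)^2) <= 72 L (D a_(K-1)^2 + 8 L C^2).
   As [(k + 2)/2 <= a_k <= k + 1], the left-hand side is of order [eps^2 K^3],
   and the right-hand side is of order [K^2], or bounded when [f] is convex. *)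
Require Import Defs.
From HB Require Import structures.
From mathcomp Require Import all_boot all_order all_algebra.
From mathcomp Require Import all_classical all_reals all_analysis.
From mathcomp Require Import ring lra.

Set Implicit Arguments.
Unset Strict Implicit.
Unset Printing Implicit Defensive.

Import Order.TTheory GRing.Theory Num.Theory.
Import numFieldNormedType.Exports.

Local Open Scope classical_set_scope.
Local Open Scope ring_scope.

(** * Euclidean geometry and gradients *)

Section EuclideanTheory.
Context {R : realType} {n : nat}.
Implicit Types (u v w x y z : 'rV[R]_n) (t c : R).

Lemma dotC u v : dot u v = dot v u.
Proof. by apply: eq_bigr => i _; rewrite mulrC. Qed.

Lemma dotDl u v w : dot (u + v) w = dot u w + dot v w.
Proof. by rewrite -big_split; apply: eq_bigr => i _; rewrite mxE mulrDl. Qed.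

Lemma dotNl u w : dot (- u) w = - dot u w.
Proof. by rewrite -sumrN; apply: eq_bigr => i _; rewrite mxE mulNr. Qed.

Lemma dotZl c u w : dot (c *: u) w = c * dot u w.
Proof. by rewrite mulr_sumr; apply: eq_bigr => i _; rewrite mxE mulrA. Qed.

Lemma dotDr u v w : dot w (u + v) = dot w u + dot w v.
Proof. by rewrite dotC dotDl !(dotC w). Qed.

Lemma dotNr u w : dot w (- u) = - dot w u.
Proof. by rewrite dotC dotNl (dotC w). Qed.

Lemma dotZr c u w : dot w (c *: u) = c * dot w u.
Proof. by rewrite dotC dotZl (dotC w). Qed.

Definition dotE := (dotDl, dotDr, dotNl, dotNr, dotZl, dotZr).

Lemma dot0l u : dot 0 u = 0.
Proof. by rewrite -(scale0r 0) dotZl mul0r. Qed.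

Lemma dot0r u : dot u 0 = 0.
Proof. by rewrite dotC dot0l. Qed.

Lemma dot_ge0 u : 0 <= dot u u.
Proof. by apply: sumr_ge0 => i _; rewrite -expr2 sqr_ge0. Qed.

Lemma dot_eq0 u : (dot u u == 0) = (u == 0).
Proof.
apply/eqP/eqP => [u0|->]; last exact: dot0l.
apply/rowP => i; rewrite mxE; apply/eqP; rewrite -sqrf_eq0 expr2.
move/eqP: u0; rewrite psumr_eq0 => [/allP/(_ i)|j _]; last by rewrite -expr2 sqr_ge0.
by apply; rewrite mem_index_enum.
Qed.

Lemma enorm_ge0 u : 0 <= enorm u.
Proof. exact: sqrtr_ge0. Qed.

Lemma enorm_sqr u : enorm u ^+ 2 = dot u u.
Proof. by rewrite sqr_sqrtr// dot_ge0. Qed.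

Lemma enorm_le u c : 0 <= c -> (enorm u <= c) = (dot u u <= c ^+ 2).
Proof. by move=> c0; rewrite -enorm_sqr ler_pXn2r// nnegrE enorm_ge0. Qed.

Lemma le_enorm u v : (enorm u <= enorm v) = (dot u u <= dot v v).
Proof. by rewrite enorm_le ?enorm_ge0// enorm_sqr. Qed.

Lemma enormN u : enorm (- u) = enorm u.
Proof. by rewrite /enorm dotNl dotNr opprK. Qed.

Lemma enormZ c u : enorm (c *: u) = `|c| * enorm u.
Proof.
by rewrite /enorm dotZl dotZr mulrA -expr2 sqrtrM ?sqr_ge0// sqrtr_sqr.
Qed.

Lemma dot_le_enorm u v : dot u v <= enorm u * enorm v.
Proof.
have [->|u0] := eqVneq u 0.
  by rewrite dot0l mulr_ge0 ?enorm_ge0.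
have uu : 0 < dot u u by rewrite lt_neqAle eq_sym dot_eq0 u0 dot_ge0.
rewrite (le_trans (ler_norm _))// -(@ler_pXn2r _ 2)// ?nnegrE ?mulr_ge0 ?enorm_ge0//.
rewrite -normrX ger0_norm ?sqr_ge0// exprMn !enorm_sqr.
(* Cauchy-Schwarz: the component of [v] orthogonal to [u] has a nonnegative square. *)
have := dot_ge0 (v - (dot u v / dot u u) *: u).
rewrite !dotE (dotC v u).
set a := dot u u in uu *; set b := dot u v; set d := dot v v => H.
have {}H : 0 <= (d - b ^+ 2 / a).
  apply: le_trans H _; rewrite le_eqVlt; apply/orP; left; apply/eqP.
  by field; rewrite gt_eqF.
move: H; rewrite subr_ge0 ler_pdivrMr//; lra.
Qed.

Lemma ler_enormD u v : enorm (u + v) <= enorm u + enorm v.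
Proof.
rewrite enorm_le ?addr_ge0 ?enorm_ge0// sqrrD !enorm_sqr !dotE (dotC v u).
have := dot_le_enorm u v; lra.
Qed.

Lemma ler_enormB u v : enorm (u - v) <= enorm u + enorm v.
Proof. by rewrite (le_trans (ler_enormD _ _))// enormN. Qed.

Lemma dot_ge_enorm u v : - (enorm u * enorm v) <= dot u v.
Proof. by rewrite lerNl -dotNl -(enormN u) dot_le_enorm. Qed.

End EuclideanTheory.

(** Stands in for letting [t] tend to 0. The first-order conditions below come from it: compare
    along a segment, divide by [t], and discard the error of order [t]. *)
Lemma le0_of_le_mul_small (R : realFieldType) (a b : R) :
  (forall t, 0 < t <= 1 -> a <= t * b) -> a <= 0.
Proof.
move=> H; rewrite leNgt; apply/negP => a0.
have b0 : 0 < b.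
  by have := H 1; rewrite ltr01 lexx mul1r => /(_ isT); exact: lt_le_trans a0.
pose t := Num.min 1 (a / (2 * b)).
have t01 : 0 < t <= 1.
  by rewrite lt_min ltr01 ge_min lexx divr_gt0// mulr_gt0.
have : t * b <= a / 2.
  have -> : a / 2 = a / (2 * b) * b by field; rewrite gt_eqF.
  by rewrite ler_pM2r// ge_min lexx orbT.
by have := H t t01; lra.
Qed.

(** * Directional derivatives and gradients *)

Section Calculus.
Context {R : realType} {n : nat}.
Implicit Types (f : 'rV[R]_n -> R) (u v w x y z : 'rV[R]_n) (t c : R).

Lemma derive_gradient f x v :
  differentiable f x -> 'D_v f x = dot (gradient f x) v.
Proof.
move=> df; rewrite deriveE// [in LHS](row_sum_delta v) linear_sum.
by apply: eq_bigr => i _; rewrite linearZ /= mxE deriveE// /GRing.scale /= mulrC.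
Qed.

Lemma sum_continuous (F : 'I_n -> 'rV[R]_n -> R) :
  (forall i, continuous (F i)) -> continuous (fun z => \sum_i F i z).
Proof.
move=> cF ?; apply: (@continuous_big R^o _ +%R 0 xpredT (@add_continuous R^o)).
by move=> i _; exact: cF.
Qed.

Lemma dot_continuous w : continuous (fun z => dot w z).
Proof.
apply: (@sum_continuous (fun i z => w 0 i * z 0 i)) => i z.
by apply: continuousM; [exact: cst_continuous|exact: coord_continuous].
Qed.

Lemma sqdist_continuous y : continuous (fun z => enorm (z - y) ^+ 2).
Proof.
have -> : (fun z => enorm (z - y) ^+ 2) =
    (fun z => \sum_i (z 0 i - y 0 i) * (z 0 i - y 0 i)).
  apply/funext => z; rewrite enorm_sqr; apply: eq_bigr => i _.
  by rewrite !mxE.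
apply: (@sum_continuous (fun i z => (z 0 i - y 0 i) * (z 0 i - y 0 i))) => i z.
have cB : {for z, continuous (fun z : 'rV[R]_n => z 0 i - y 0 i)}.
  by apply: continuousB; [exact: coord_continuous|exact: cst_continuous].
exact: (continuousM cB cB).
Qed.

Lemma is_derive_sqdist c x y v :
  is_derive x v (fun z => c * enorm (z - y) ^+ 2) (2 * c * dot (x - y) v).
Proof.
suff H : (fun h : R => h^-1 *: (((fun z => c * enorm (z - y) ^+ 2) \o shift x) (h *: v)
   - c * enorm (x - y) ^+ 2)) @ 0^' --> 2 * c * dot (x - y) v.
  split; first by apply/cvg_ex; eexists; exact: H.
  exact: (cvg_lim _ H).
(* For this quadratic the difference quotient is exactly affine in [h], with the claimed derivative
   as constant term. *)
apply: (@cvg_trans _ ((fun h : R => 2 * c * dot (x - y) v + h * (c * dot v v)) @ 0^')).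
  apply: near_eq_cvg; near=> h => /=.
  rewrite !enorm_sqr /GRing.scale /= !dotE !(dotC v) !(dotC y x).
  field; near: h; exact: nbhs_dnbhs_neq.
apply: cvg_within_filter.
have : (2 * c * dot (x - y) v + h * (c * dot v v)) @[h --> 0] -->
    2 * c * dot (x - y) v + 0 * (c * dot v v).
  by apply: cvgD; [exact: cvg_cst|apply: cvgM; [exact: cvg_id|exact: cvg_cst]].
by rewrite mul0r addr0.
Unshelve. all: by end_near. Qed.

Lemma gradientD_sqdist f c x y : differentiable f x ->
  gradient (fun z => f z + c * enorm (z - y) ^+ 2) x =
  gradient f x + (2 * c) *: (x - y).
Proof.
move=> df; apply/rowP => i; rewrite !mxE.
have dq := is_derive_sqdist c x y (delta_mx 0 i).
have dfi : derivable f x (delta_mx 0 i) by exact: diff_derivable.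
have := @deriveD _ _ _ f (fun z => c * enorm (z - y) ^+ 2) x (delta_mx 0 i)
  dfi (@ex_derive _ _ _ _ _ _ _ dq).
rewrite (@derive_val _ _ _ _ _ _ _ dq) => ->; congr (_ + _).
rewrite /dot (bigD1 i)//= !mxE !eqxx mulr1 big1 ?addr0// => j ji.
by rewrite [delta_mx _ _ _ _]mxE (negbTE ji) andbF mulr0.
Qed.

Lemma is_derive_line f x v t : differentiable f (x + t *: v) ->
  is_derive t 1 (fun s => f (x + s *: v)) (dot (gradient f (x + t *: v)) v).
Proof.
move=> df.
have E : (fun h : R => h^-1 *: (((fun s => f (x + s *: v)) \o shift t) (h *: 1)
    - f (x + t *: v))) =
  (fun h : R => h^-1 *: ((f \o shift (x + t *: v)) (h *: v) - f (x + t *: v))).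
  apply/funext => h /=; congr (_ *: (f _ - _)).
  by rewrite [h *: 1]mulr1 scalerDl addrCA.
split; first by rewrite /derivable E; exact: diff_derivable.
by rewrite /derive E -derive_gradient.
Qed.

End Calculus.

(** * Convexity and the descent lemma *)

Section ConvexSets.
Context {R : realType} {n : nat}.
Implicit Types (Omega : set 'rV[R]_n) (f : 'rV[R]_n -> R) (x y z p : 'rV[R]_n).

Lemma convex_set_line Omega x y t : convex_set Omega -> Omega x -> Omega y ->
  0 <= t <= 1 -> Omega (x + t *: (y - x)).
Proof.
move=> cvx Ox Oy /andP[t0 t1].
have /set_mem := cvx y x (Itv01 t0 t1) (mem_set Oy) (mem_set Ox).
congr Omega; rewrite /conv /= scalerBl scalerBr scale1r.
by rewrite addrC -addrA [- _ + _]addrC.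
Qed.

Lemma convex_function_line Omega f x y t : convex_function Omega f ->
  Omega x -> Omega y -> 0 <= t <= 1 ->
  f (x + t *: (y - x)) <= f x + t * (f y - f x).
Proof.
move=> cvx Ox Oy /andP[t0 t1].
have H : f (t *: y + (1 - t) *: x) <= t * f y + (1 - t) * f x :=
  cvx (Itv01 t0 t1) y x (mem_set Oy) (mem_set Ox).
have -> : x + t *: (y - x) = t *: y + (1 - t) *: x.
  by rewrite scalerBl scalerBr scale1r [in LHS]addrC -addrA [- _ + _]addrC.
apply: le_trans H _; rewrite le_eqVlt; apply/orP; left; apply/eqP; ring.
Qed.

Lemma projection_nonexpansive Omega x p z : convex_set Omega ->
  is_projection Omega x p -> Omega z -> enorm (z - p) <= enorm (z - x).
Proof.
move=> cvx [Op minp] Oz.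
(* The variational inequality of the projection, found by moving from [p] towards [z] inside
   [Omega]. *)
have obtuse : 2 * dot (x - p) (z - p) <= 0.
  apply: (@le0_of_le_mul_small _ _ (dot (z - p) (z - p))) => t /andP[t0 t1].
  have Oq : Omega (p + t *: (z - p)).
    by apply: convex_set_line; rewrite // t1 ltW.
  have := minp _ Oq; rewrite le_enorm.
  have -> : x - (p + t *: (z - p)) = (x - p) - t *: (z - p).
    by rewrite opprD addrA.
  move: (x - p) (z - p) => a b; rewrite !dotE (dotC b a) => H.
  rewrite -(ler_pM2l t0); nra.
rewrite le_enorm.
have -> : z - x = (z - p) - (x - p) by rewrite opprB addrA subrK.
move: obtuse; have := dot_ge0 (x - p).
move: (x - p) (z - p) => a b; rewrite !dotE (dotC b a); lra.
Qed.

End ConvexSets.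

Section SmoothFunctions.
Context {R : realType} {n : nat}.
Variables (Omega : set 'rV[R]_n) (f : 'rV[R]_n -> R) (L : R).
Hypothesis Omega_convex : convex_set Omega.
Hypothesis f_diff : forall u, Omega u -> differentiable f u.
Hypothesis f_lip : forall u1 u2, Omega u1 -> Omega u2 ->
  enorm (gradient f u1 - gradient f u2) <= L * enorm (u1 - u2).
Implicit Types x y : 'rV[R]_n.

Lemma gradient_lip_dot x y c : Omega x -> Omega y -> 0 <= c <= 1 ->
  `|dot (gradient f (x + c *: (y - x)) - gradient f x) (y - x)|
    <= c * (L * enorm (y - x) ^+ 2).
Proof.
move=> Ox Oy /andP[c0 c1]; set d := y - x.
set g := _ - gradient f x.
have gle : enorm g * enorm d <= c * (L * enorm d ^+ 2).
  have Oc : Omega (x + c *: d) by apply: convex_set_line; rewrite // c0.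
  have := f_lip Oc Ox.
  rewrite [x + _]addrC addrK enormZ ger0_norm// [_ + x]addrC -/g => gle.
  have := ler_wpM2r (enorm_ge0 d) gle.
  by rewrite expr2 !mulrA (mulrC c).
rewrite ler_norml; apply/andP; split.
  by have := dot_ge_enorm g d; lra.
by have := dot_le_enorm g d; lra.
Qed.

(** Mean value theorem on the segment for [f] minus its linear part and [t ^+ 2 * kappa]. The
    quadratic correction yields the sharp constant [L / 2] without integration. *)
Lemma linearization_error_mean_value x y kappa : Omega x -> Omega y ->
  exists2 c, 0 <= c <= 1 & f y - linearization f y x - kappa =
    dot (gradient f (x + c *: (y - x)) - gradient f x) (y - x) - 2 * c * kappa.
Proof.
move=> Ox Oy; set d := y - x.
have Oline (t : R) : 0 <= t <= 1 -> Omega (x + t *: d) by exact: convex_set_line.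
pose psi t := f (x + t *: d) - (t * dot (gradient f x) d + t ^+ 2 * kappa).
have dpsi (t : R) : 0 <= t <= 1 -> is_derive t 1 psi
    (dot (gradient f (x + t *: d)) d - (dot (gradient f x) d + 2 * t * kappa)).
  move=> t01; have df := is_derive_line (f_diff (Oline t t01)).
  have H : is_derive t 1 (fun s : R => s * dot (gradient f x) d + s ^+ 2 * kappa)
      (dot (gradient f x) d + 2 * t * kappa).
    apply: is_derive_eq; rewrite /GRing.scale /=; ring.
  exact: is_deriveB df H.
have [c c01 E] : exists2 c, c \in `]0, 1[%R & psi 1 - psi 0 =
    (dot (gradient f (x + c *: d)) d
      - (dot (gradient f x) d + 2 * c * kappa)) * (1 - 0).
  apply: (@MVT _ psi (fun c => dot (gradient f (x + c *: d)) d
      - (dot (gradient f x) d + 2 * c * kappa)) 0 1 ltr01) => [t|].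
    by rewrite in_itv /= => /andP[t0 t1]; apply: dpsi; rewrite !ltW.
  apply: derivable_within_continuous => t; rewrite in_itv /= => t01.
  exact: (@ex_derive _ _ _ _ _ _ _ (dpsi t t01)).
move: c01; rewrite in_itv /= => /andP[c0 c1]; exists c; first by rewrite !ltW.
rewrite dotDl dotNl /linearization -/d; move: E; rewrite /psi scale0r scale1r addr0.
have -> : x + d = y by rewrite addrC subrK.
lra.
Qed.

Lemma linearization_error x y : Omega x -> Omega y ->
  `|f y - linearization f y x| <= L / 2 * enorm (y - x) ^+ 2.
Proof.
move=> Ox Oy; set D := enorm (y - x) ^+ 2.
rewrite ler_norml; apply/andP; split.
  (* [kappa] is the bound to be proved, with its sign; the Lipschitz estimate then fixes the sign of
     the right-hand side whatever [c] is. *)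
  have [c c01] := linearization_error_mean_value (- (L / 2 * D)) Ox Oy.
  have := gradient_lip_dot Ox Oy c01; rewrite -/D ler_norml => /andP[]; lra.
have [c c01] := linearization_error_mean_value (L / 2 * D) Ox Oy.
have := gradient_lip_dot Ox Oy c01; rewrite -/D ler_norml => /andP[]; lra.
Qed.

(* The descent lemma gives the tangent inequality along a segment up to an
   error quadratic in [t], which disappears as [t] tends to 0. *)
Lemma convex_linearization_le x y : convex_function Omega f ->
  Omega x -> Omega y -> linearization f y x <= f y.
Proof.
move=> cvx Ox Oy; rewrite -subr_le0.
apply: (@le0_of_le_mul_small _ _ (L / 2 * enorm (y - x) ^+ 2)) => t /andP[t0 t1].
have t01 : 0 <= t <= 1 by rewrite t1 ltW.
have := convex_function_line cvx Ox Oy t01.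
have := linearization_error Ox (convex_set_line Omega_convex Ox Oy t01).
rewrite /linearization [x + _]addrC addrK [_ + x]addrC dotZr enormZ exprMn.
rewrite (ger0_norm (ltW t0)) ler_norml => /andP[+ _].
move: (f _) (enorm _ ^+ 2) => q e H1 H2.
rewrite -(ler_pM2l t0); nra.
Qed.

End SmoothFunctions.

(** * Existence of minimizers and optimality conditions *)

Section LowerSemicontinuity.
Context {R : realType} {T : ptopologicalType}.
Implicit Types (h : T -> \bar R) (g : T -> R) (K : set T).
Local Open Scope ereal_scope.

Lemma lsc_open_gt h (b : \bar R) : lower_semicontinuous h -> -oo < b ->
  open [set y | b < h y].
Proof.
move=> /lower_semicontinuousP lsc; case: b => [r _|_|//]; first exact: lsc.
rewrite (_ : [set y | _] = set0); first exact: open0.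
by apply/seteqP; split => y //=; rewrite ltNge leey.
Qed.

Lemma seq_argmin (I : eqType) (h : I -> \bar R) x s :
  exists2 u, u \in x :: s & forall v, v \in x :: s -> h u <= h v.
Proof.
elim: s x => [|y s IH] x.
  by exists x; rewrite ?mem_head// => v; rewrite inE => /eqP ->.
have [u us umin] := IH y.
have [xu|ux] := leP (h x) (h u).
  exists x; rewrite ?mem_head// => v; rewrite inE => /predU1P[->//|vs].
  exact: le_trans xu (umin v vs).
exists u; first by rewrite inE us orbT.
by move=> v; rewrite inE => /predU1P[->|/umin//]; exact: ltW.
Qed.

(* Otherwise the open sets [h > h u], for [u] in [K], cover [K]; but a point
   of least value among the indices of a finite subcover is not covered. *)
Lemma lsc_compact_argmin h K : lower_semicontinuous h -> (forall y, -oo < h y) ->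
  compact K -> K !=set0 -> exists2 c, K c & forall y, K y -> h c <= h y.
Proof.
move=> lsc hNy cK [y0 Ky0]; apply: contrapT => nomin.
have cover_K : K `<=` cover K (fun u => [set y | h u < h y]).
  move=> y Ky; apply: contrapT => ny; apply: nomin; exists y => // u Ku.
  by rewrite leNgt; apply/negP => uy; apply: ny; exists u.
move: cK; rewrite compact_cover.
have openK u : K u -> open [set y | h u < h y] by move=> _; exact: lsc_open_gt.
move=> /(_ T K (fun u => [set y | h u < h y]) openK cover_K)[D DK KD].
have [v vD _] := KD _ Ky0.
have {}vD : v \in finmap.enum_fset D by [].
case ED : (finmap.enum_fset D) => [|x s]; first by rewrite ED in vD.
have [u us umin] := seq_argmin h x s.
have uD : u \in finmap.enum_fset D by rewrite ED.
have [w wD /=] := KD _ (set_mem (DK _ uD)).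
apply/negP; rewrite -leNgt; apply: umin.
by rewrite -ED; exact: wD.
Qed.

Lemma lscD_continuous h g : lower_semicontinuous h -> continuous g ->
  lower_semicontinuous (fun y => h y + (g y)%:E).
Proof.
move=> lsc cg x a ax.
(* Split [a] as [b + (a - b)] with [b] below [h x] and [a - b] below [g x]; each part stays below
   near [x]. *)
have [b ab bh] : exists2 b : R, (a - g x < b)%R & b%:E < h x.
  move: ax; case: (h x) => [r|_|//].
    rewrite -EFinD lte_fin => ar; exists ((a - g x + r) / 2)%R; rewrite ?lte_fin; lra.
  by exists (a - g x + 1)%R; rewrite ?ltrDl ?ltry.
have [V xV Vb] := lsc x b bh.
exists (V `&` [set y | a - b < g y]%R); last first.
  move=> y [/Vb by_ /= gy]; have -> : a = (b + (a - b))%R by lra.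
  by rewrite EFinD lteD// lte_fin.
apply: filterI => //.
by apply: (cvgr_gt (g x) (cg x)); lra.
Qed.

Lemma continuous_lsc g : continuous g -> lower_semicontinuous (fun y => (g y)%:E).
Proof.
move=> cg x a; rewrite lte_fin => ax.
exists [set y | a < g y]%R; first exact: (cvgr_gt (g x) (cg x)).
by move=> y /=; rewrite lte_fin.
Qed.

End LowerSemicontinuity.

Section Minimization.
Context {R : realType} {n : nat}.
Implicit Types (h : 'rV[R]_n -> \bar R) (g : 'rV[R]_n -> R).
Implicit Types (Omega : set 'rV[R]_n) (u w x y z : 'rV[R]_n).

Lemma norm_le_enorm u : `|u| <= enorm u.
Proof.
rewrite [leLHS]/Num.norm /= mx_normrE; apply/bigmax_leP; split => [|[i j] _ /=].
  exact: enorm_ge0.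
rewrite ord1 -(@ler_pXn2r _ 2)// ?nnegrE ?enorm_ge0// enorm_sqr real_normK ?num_real//.
rewrite /dot (bigD1 j)//= expr2 lerDl; apply: sumr_ge0 => k _.
by rewrite -expr2 sqr_ge0.
Qed.

Lemma argmin_exists h g : proper_efun h -> lower_semicontinuous h ->
  closed (edom h) -> bounded_set (edom h) -> continuous g ->
  exists y, y \in argmin (fun z => h z + (g z)%:E)%E.
Proof.
move=> [hNy dom0] lsc cl bd cg.
have lscG := lscD_continuous lsc cg.
have GNy y : (-oo < h y + (g y)%:E)%E.
  by have := hNy y; case: (h y) => //= r _; rewrite -EFinD ltNyr.
have [c cdom cmin] := lsc_compact_argmin lscG GNy (bounded_closed_compact bd cl) dom0.
exists c; apply/mem_set => u.
have [hu|/negP] := pselect (edom h u); first exact: cmin.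
by rewrite /edom /= -leNgt leye_eq => /eqP ->; rewrite leey.
Qed.

Lemma projection_exists Omega x : closed Omega -> Omega !=set0 ->
  exists p, is_projection Omega x p.
Proof.
move=> cl [z0 Oz0].
pose q z := enorm (z - x) ^+ 2.
have cq : continuous q by exact: sqdist_continuous.
(* [Omega] may be unbounded; cutting it with the ball about [x] through [z0] gives a compact set. *)
pose K := Omega `&` [set z | q z <= q z0].
have Kcl : closed K.
  apply: closedI => //; apply: (@preimage_closed _ _ q [set r | r <= q z0]) => //.
have Kbd : bounded_set K.
  exists (`|x| + enorm (z0 - x)); split; first exact: num_real.
  move=> b /ltW + z [_ /= qz]; apply: le_trans.
  rewrite -[z](subrK x) addrC (le_trans (ler_normD _ _))// lerD2l.
  by rewrite (le_trans (norm_le_enorm _))// le_enorm -!enorm_sqr.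
have K0 : K !=set0 by exists z0; split => //=.
have [p [Op _] pmin] := lsc_compact_argmin (continuous_lsc cq)
  (fun y => ltNyr _) (bounded_closed_compact Kbd Kcl) K0.
exists p; split => // z Oz.
rewrite -(enormN (x - p)) -(enormN (x - z)) !opprB le_enorm -!enorm_sqr.
have [Kz|] := pselect (K z); first by have := pmin z Kz; rewrite lee_fin.
move=> nKz; have zz0 : q z0 < q z by rewrite ltNge; apply/negP => ?; apply: nKz.
have : q p <= q z0 by have := pmin z0; rewrite lee_fin; apply; split => //=.
by move/le_trans; apply; exact: ltW.
Qed.

(** Fermat's rule by hand: compare [y] with [t *: u + (1 - t) *: y]. Convexity of [h] bounds its
    change by [t] times the difference, and the quadratic leaves a remainder of order [t ^+ 2]. *)
Lemma argmin_subgradient h c w kappa x y : proper_efun h -> convex_efun h ->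
  y \in argmin (fun z => (c + dot w (z - x))%:E + h z
                          + (kappa * enorm (z - x) ^+ 2)%:E)%E ->
  edom h y /\ subdifferential h y (- w - (2 * kappa) *: (y - x)).
Proof.
move=> [hNy [y0 dy0]] cvx /set_mem miny.
have dy : edom h y.
  have := miny y0; rewrite /edom /=; move: dy0 (hNy y0) (hNy y); rewrite /edom /=.
  by case: (h y0) => // r _ _; case: (h y) => // ?; rewrite ltry.
split=> // u; move: (hNy u); case Eu : (h u) => [hu||//] _; last by rewrite leey.
have : (h y < +oo)%E by []; move: (hNy y).
case Ey : (h y) => [hy||//]; rewrite ?ltxx// => _ _.
rewrite -EFinD lee_fin -subr_le0.
apply: (@le0_of_le_mul_small _ _ (kappa * dot (u - y) (u - y))) => t /andP[t0 t1].
have /(cvx u y) : 0 <= t <= 1 by rewrite t1 ltW.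
have := miny (t *: u + (1 - t) *: y); have := hNy (t *: u + (1 - t) *: y).
rewrite Eu Ey; case: (h _) => [hz||//] _; last by rewrite -!EFinM -EFinD leye_eq.
rewrite -!EFinM -!EFinD !lee_fin !enorm_sqr.
have -> : t *: u + (1 - t) *: y - x = (y - x) + t *: (u - y).
  rewrite scalerBl scale1r scalerBr; apply/rowP => i; rewrite !mxE; ring.
move: (u - y) (y - x) => a b; rewrite !dotE (dotC a b) => H1 H2.
rewrite -(ler_pM2l t0); nra.
Qed.

End Minimization.

(** * Convergence of the iterates *)

(** The map [t * (t - 1)] increases for [t >= 1 / 2]; its values at [b + 1 / 2] and [b + 1] are
    [b ^+ 2 - 1 / 4] and [b ^+ 2 + b]. *)
Lemma extrapolation_bounds (R : realFieldType) (a b : R) : 1 <= b -> 0 < a ->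
  a * (a - 1) = b ^+ 2 -> b + 2^-1 <= a <= b + 1.
Proof.
move=> b1 a0 E.
have a1 : 1 < a by rewrite ltNge; apply/negP => a1; nra.
apply/andP; split; rewrite leNgt; apply/negP => H; nra.
Qed.

(** Passing from [K] to [K + 1], the left-hand side grows by [(3 K^2 + 3 K + 1) / 12], at most
    [(K + 1)^2 / 4]. *)
Lemma sum_sqr_ge_cube (R : realFieldType) (a : nat -> R) K :
  (forall k, (k.+1)%:R / 2 <= a k) ->
  K%:R ^+ 3 / 12 <= \sum_(k < K) a k ^+ 2.
Proof.
move=> ak; elim: K => [|K IH]; first by rewrite big_ord0 expr0n mul0r.
rewrite big_ord_recr /=; have := ak K; rewrite -natr1.
have K0 : 0 <= K%:R :> R by rewrite ler0n.
move: (\sum_(_ < _) _) (a K) (K%:R) IH K0 => s b c; nra.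
Qed.

(** * Algebra of one accelerated step *)

Section AcceleratedStep.
Context {R : realType} {n : nat}.
Implicit Types (x p q z g : 'rV[R]_n).

(** Here [p], [q], [x] are [y_(k-1)], [y_k], [x_k], and [s] is the subgradient of [h] at [q] given
    by optimality. [E] is the error of the tangent inequality at [z]. *)
Lemma accelerated_step (L l a E D W fx fp fq fz hp hq hz : R) x p q z g :
  let s := - (g + l *: (x - p)) - (4 * L) *: (q - x) in
  0 < L -> 0 <= l <= L -> 1 <= a ->
  fq <= fx + dot g (q - x) + L / 2 * dot (q - x) (q - x) ->
  fx + dot g (p - x) - l / 2 * dot (p - x) (p - x) <= fp ->
  fx + dot g (z - x) - E <= fz ->
  hq + dot s (p - q) <= hp -> hq + dot s (z - q) <= hz ->
  E + l / 2 * (dot (z - p) (z - p) - dot (z - x) (z - x)) <= D ->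
  dot ((a - 1) *: (p - x) + (z - x)) ((a - 1) *: (p - x) + (z - x)) <= W ->
  a ^+ 2 * (fq + hq - (fz + hz))
    + a ^+ 2 * (L * dot (q - x) (q - x) + l / 2 * dot (q - p) (q - p))
    + 2 * L * dot (z - (a *: q - (a - 1) *: p)) (z - (a *: q - (a - 1) *: p))
  <= a * (a - 1) * (fp + hp - (fz + hz)) + a * D + 2 * L * W.
Proof.
move=> s L0 /andP[l0 lL] a1.
(* With all vectors based at [x], the claim becomes linear in the inner products of [Q], [P],
   [Z]. *)
have -> : z - (a *: q - (a - 1) *: p) =
    (z - x) + (a - 1) *: (p - x) - a *: (q - x).
  by apply/rowP => i; rewrite !mxE; ring.
have -> : q - p = (q - x) - (p - x) by apply/rowP => i; rewrite !mxE; ring.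
have -> : z - p = (z - x) - (p - x) by apply/rowP => i; rewrite !mxE; ring.
have -> : z - q = (z - x) - (q - x) by apply/rowP => i; rewrite !mxE; ring.
have -> : p - q = (p - x) - (q - x) by apply/rowP => i; rewrite !mxE; ring.
rewrite {}/s -(opprB p x).
move: (q - x) (p - x) (z - x) => Q P Z.
have := dot_ge0 Q; rewrite !dotE (dotC Q P) (dotC Z P) (dotC Z Q).
move: (dot g Q) (dot g P) (dot g Z) (dot Q Q) (dot P P) (dot Z Z).
move: (dot P Q) (dot P Z) (dot Q Z).
move=> PQ PZ QZ gQ gP gZ QQ PP ZZ QQ0 Hfq Hfp Hfz Hhp Hhz HD HW.
have a0 : 0 <= a by lra.
have aa : 0 <= a * (a - 1) by nra.
have a2 : 0 <= a ^+ 2 by exact: sqr_ge0.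
(* The weights are [a ^+ 2] at [q], [a * (a - 1)] at [p] and [a] at [z], so those at [p] and [z] sum
   to the one at [q]. *)
have {}Hfq := ler_wpM2l a2 Hfq.
have {}Hfp := ler_wpM2l aa Hfp.
have {}Hfz := ler_wpM2l a0 Hfz.
have {}Hhp := ler_wpM2l aa Hhp.
have {}Hhz := ler_wpM2l a0 Hhz.
have {}HD := ler_wpM2l a0 HD.
have L2 : 0 <= 2 * L by lra.
have {}HW := ler_wpM2l L2 HW.
(* The proximal term supplies [4 L] for [QQ], while [7 L / 2 + l / 2] is consumed; half of this
   quantity is the slack. *)
have HlL : 0 <= a ^+ 2 * ((L - l) * QQ).
  by apply: mulr_ge0 => //; apply: mulr_ge0 => //; rewrite subr_ge0.
lra.
Qed.

End AcceleratedStep.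

(** * Estimates along a run of the algorithm *)

Section Iterates.
Context {R : realType} {n : nat}.
Variables (Omega : set 'rV[R]_n) (f : 'rV[R]_n -> R) (h : 'rV[R]_n -> \bar R).
Variables (L C : R) (y0 : 'rV[R]_n) (S : iterates R n).
Hypothesis Omega_convex : convex_set Omega.
Hypothesis L_gt0 : 0 < L.
Hypothesis f_diff : forall u, Omega u -> differentiable f u.
Hypothesis f_lip : forall u1 u2, Omega u1 -> Omega u2 ->
  enorm (gradient f u1 - gradient f u2) <= L * enorm (u1 - u2).
Hypothesis h_proper : proper_efun h.
Hypothesis h_convex : convex_efun h.
Hypothesis dom_sub : edom h `<=` Omega.
Hypothesis C_gt0 : 0 < C.
Hypothesis dom_le : forall y, edom h y -> enorm y <= C.
Hypothesis y0_dom : edom h y0.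
Hypothesis run : mFISTA_run f h Omega L y0 S.

Let x := iter_x S.
Let y := iter_y S.
Let v := iter_v S.
Let a := iter_a S.
Let l := iter_L S.

Let x1 : x 1%N = y0. Proof. by case: run. Qed.
Let y_0 : y 0%N = y0. Proof. by case: run. Qed.
Let a_0 : a 0%N = 1. Proof. by case: run. Qed.
Let l1 : l 1%N = 0. Proof. by case: run. Qed.

Let a_rec k : 0 < a k.+1 /\ a k.+1 * (a k.+1 - 1) = a k ^+ 2.
Proof. by case: run => _ _ _ _ /(_ k.+1 isT)[]. Qed.

Lemma iter_a_bounds k : k.+2%:R / 2 <= a k <= k.+1%:R.
Proof.
elim: k => [|k /andP[IHl IHu]]; first by rewrite a_0 divff ?lexx.
have ak1 : 1 <= a k.
  by apply: le_trans IHl; rewrite ler_pdivlMr// mul1r ler_nat.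
have [a0 aE] := a_rec k.
have /andP[] := extrapolation_bounds ak1 a0 aE.
move: IHl IHu; rewrite -!(natr1 k.+2) -!(natr1 k.+1); lra.
Qed.

Lemma iter_a_ge1 k : 1 <= a k.
Proof.
have /andP[+ _] := iter_a_bounds k; apply: le_trans.
by rewrite ler_pdivlMr// mul1r ler_nat.
Qed.

Lemma iter_x_Omega k : Omega (x k.+1).
Proof.
case: k => [|k]; first by rewrite x1; exact: dom_sub.
by case: run => _ _ _ _ /(_ k.+1 isT)[_ _ _ [+ _] _].
Qed.

Lemma iter_y_optimality k : edom h (y k.+1) /\
  subdifferential h (y k.+1)
    (- (gradient f (x k.+1) + l k.+1 *: (x k.+1 - y k))
     - (4 * L) *: (y k.+1 - x k.+1)).
Proof.
case: run => _ _ _ _ /(_ k.+1 isT)[+ _ _ _ _] => Hargmin.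
have [dy] := argmin_subgradient h_proper h_convex Hargmin.
rewrite gradientD_sqdist; last exact/f_diff/iter_x_Omega.
have -> : 2 * (l k.+1 / 2) = l k.+1 by lra.
by rewrite mulrA -natrM.
Qed.

Lemma iter_y_dom k : edom h (y k).
Proof. by case: k => [|k]; [rewrite y_0|case: (iter_y_optimality k)]. Qed.

(** [v_k] is defined so that subtracting the gradient at [y_k] leaves exactly the subgradient from
    the optimality condition. *)
Lemma iter_v_subgradient k :
  subdifferential h (y k.+1) (v k.+1 - gradient f (y k.+1)).
Proof.
case: run => _ _ _ _ /(_ k.+1 isT)[_ _ vE _ _].
rewrite -/x -/y -/v -/l /= in vE.
have [_] := iter_y_optimality k.
congr (subdifferential _ _ _); rewrite vE.
by apply/rowP => i; rewrite !mxE; ring.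
Qed.

(** When [y_k] and [x_(k+1)] differ, [A_k] is the least curvature correction putting the model at
    [x_(k+1)] below [f] at [y_k]. The descent lemma bounds it by [L]; the tangent inequality makes
    it nonpositive for convex [f]. *)
Lemma iter_L_bounds k :
  [/\ 0 <= l k.+1 <= L,
      linearization f (y k) (x k.+1)
        - l k.+1 / 2 * dot (y k - x k.+1) (y k - x k.+1) <= f (y k) &
      convex_function Omega f -> l k.+1 = 0].
Proof.
case: k => [|k].
  (* The first iteration has [x_1 = y_0], where the linearization is exact. *)
  rewrite l1 x1 y_0 /linearization subrr !dot0r lexx ltW//.
  by split => //; lra.
case: run => _ _ _ _ /(_ k.+1 isT)[_ _ _ _ [AE lE]].
rewrite -/x -/y -/l /= in AE lE.
have Oy : Omega (y k.+1) by exact/dom_sub/iter_y_dom.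
have Ox := iter_x_Omega k.+1.
have Al : iter_A S k.+1 <= l k.+2 by rewrite lE le_max lexx orbT.
have l0 : 0 <= l k.+2 by rewrite lE le_max lexx.
have [yx|yx] := eqVneq (y k.+1) (x k.+2).
  rewrite yx eqxx in AE; rewrite lE AE maxxx -yx.
  rewrite /linearization subrr !dot0r lexx ltW//.
  by split => //; lra.
have d0 : 0 < dot (y k.+1 - x k.+2) (y k.+1 - x k.+2).
  by rewrite lt_neqAle eq_sym dot_eq0 subr_eq0 yx dot_ge0.
rewrite (negbTE yx) enorm_sqr in AE.
have {}AE : iter_A S k.+1 * dot (y k.+1 - x k.+2) (y k.+1 - x k.+2) =
    2 * (linearization f (y k.+1) (x k.+2) - f (y k.+1)).
  by rewrite AE divfK// gt_eqF.
split.
- rewrite l0 lE ge_max (ltW L_gt0) /= -(ler_pM2r d0) AE.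
  have := linearization_error Omega_convex f_diff f_lip Ox Oy.
  rewrite enorm_sqr ler_norml => /andP[]; lra.
- have := ler_wpM2r (ltW d0) Al; rewrite AE; lra.
- move=> cvx; rewrite lE; apply/max_idPl.
  rewrite -(ler_pM2r d0) AE mul0r.
  have := convex_linearization_le Omega_convex f_diff f_lip cvx Ox Oy; lra.
Qed.

Let x_projection k : is_projection Omega
  (y k.+1 + ((a k - 1) / a k.+1) *: (y k.+1 - y k)) (x k.+2).
Proof. by case: run => _ _ _ _ /(_ k.+1 isT)[]. Qed.

(* The auxiliary sequence of FISTA: up to the projection, [x k.+1] is
   [y k + (1 / a k) *: (fista_point k - y k)]. *)
Definition fista_point k :=
  if k is j.+1 then a j *: y j.+1 - (a j - 1) *: y j else y0.

Lemma dom_dist z1 z2 : edom h z1 -> edom h z2 -> enorm (z1 - z2) <= 2 * C.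
Proof.
move=> /dom_le H1 /dom_le H2; have := ler_enormB z1 z2; lra.
Qed.

(** The point [x_k] may leave [edom h]. Before projection it is at distance at most [2 C + 2 C] from
    [z], since the extrapolation factor is at most 1; projecting onto [Omega] brings it no farther
    from [z]. *)
Lemma dist_iter_x z k : edom h z -> enorm (z - x k.+1) <= 4 * C.
Proof.
move=> dz; case: k => [|k].
  by rewrite x1 (le_trans (dom_dist dz y0_dom))//; have := C_gt0; lra.
apply: le_trans (projection_nonexpansive Omega_convex (x_projection k) (dom_sub dz)) _.
rewrite opprD addrA (le_trans (ler_enormB _ _))// enormZ.
have [a0 aE] := a_rec k; have ak1 := iter_a_ge1 k.
have /andP[aL _] := extrapolation_bounds ak1 a0 aE.
have c1 : `|(a k - 1) / a k.+1| <= 1.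
  by rewrite ger0_norm ?divr_ge0 ?subr_ge0 ?(ltW a0)// ler_pdivrMr//; lra.
have H1 := dom_dist dz (iter_y_dom k.+1).
have H2 := dom_dist (iter_y_dom k.+1) (iter_y_dom k).
have := ler_pM (normr_ge0 _) (enorm_ge0 _) c1 H2; lra.
Qed.

(** The test point [u] lies in [Omega], so the projection brings [x_(k+1)] no farther from it.
    Scaling by [a_k] turns the two distances into the two sides; for [k = 0] they agree. *)
Lemma dist_fista_point z k : edom h z ->
  dot ((a k - 1) *: (y k - x k.+1) + (z - x k.+1))
      ((a k - 1) *: (y k - x k.+1) + (z - x k.+1))
  <= dot (z - fista_point k) (z - fista_point k).
Proof.
move=> dz; case: k => [|k].
  by rewrite a_0 subrr scale0r add0r x1.
have [a0 aE] := a_rec k; have a1 := iter_a_ge1 k.+1.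
have aN0 : a k.+1 != 0 by rewrite gt_eqF.
pose u := y k.+1 + (a k.+1)^-1 *: (z - y k.+1).
have Ou : Omega u.
  apply: convex_set_line => //; [exact/dom_sub/iter_y_dom|exact: dom_sub|].
  by rewrite invr_ge0 (ltW a0) invf_le1.
have := projection_nonexpansive Omega_convex (x_projection k) Ou.
have a_ge0 : 0 <= `|a k.+1| by [].
move/(ler_wpM2l a_ge0); rewrite -!enormZ le_enorm.
have -> : a k.+1 *: (u - x k.+2) =
    (a k.+1 - 1) *: (y k.+1 - x k.+2) + (z - x k.+2).
  by apply/rowP => i; rewrite !mxE; field.
have -> // : a k.+1 *: (u - (y k.+1 + ((a k - 1) / a k.+1) *: (y k.+1 - y k))) =
    z - fista_point k.+1.
by apply/rowP => i; rewrite !mxE; field.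
Qed.

(** Only evaluated in [edom h], where [h] is finite and [fine] loses nothing. *)
Let F u := f u + fine (h u).
(** Index shift: [residual k] belongs to iteration [k + 1], weighted by [a k]. *)
Let residual k := L * dot (y k.+1 - x k.+1) (y k.+1 - x k.+1)
  + l k.+1 / 2 * dot (y k.+1 - y k) (y k.+1 - y k).

Lemma subgradient_fine u w s : edom h u -> edom h w -> subdifferential h u s ->
  fine (h u) + dot s (w - u) <= fine (h w).
Proof.
case: h_proper => hNy _ + + /(_ w); rewrite /edom /=; move: (hNy u) (hNy w).
by case: (h u) => [r||]//; case: (h w) => [r'||]//; rewrite -EFinD lee_fin.
Qed.

Lemma iterate_step z k D : edom h z ->
  D = 10 * L * C ^+ 2 \/ convex_function Omega f /\ D = 0 ->
  a k ^+ 2 * (F (y k.+1) - F z) + a k ^+ 2 * residual k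
    + 2 * L * dot (z - fista_point k.+1) (z - fista_point k.+1)
  <= a k * (a k - 1) * (F (y k) - F z) + a k * D
    + 2 * L * dot (z - fista_point k) (z - fista_point k).
Proof.
move=> dz HD.
have [dy sub] := iter_y_optimality k.
have [l_bd l_tangent l_cvx] := iter_L_bounds k.
have Ox := iter_x_Omega k.
have dyk := iter_y_dom k.
have err_y := linearization_error Omega_convex f_diff f_lip Ox (dom_sub dy).
have err_z := linearization_error Omega_convex f_diff f_lip Ox (dom_sub dz).
have [E [Efz ED]] : exists E, linearization f z (x k.+1) - E <= f z /\
    E + l k.+1 / 2 * (dot (z - y k) (z - y k)
                      - dot (z - x k.+1) (z - x k.+1)) <= D.
  case: HD => [->|[cvx ->]].
    (* The total is [(L - l) / 2] times the squared distance to [x], plus [l / 2] times that to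
       [y_k]: at most [8 L C^2 + 2 L C^2]. *)
    exists (L / 2 * dot (z - x k.+1) (z - x k.+1)); split.
      by move: err_z; rewrite enorm_sqr ler_norml => /andP[]; lra.
    have C4 : 0 <= 4 * C by have := C_gt0; lra.
    have C2 : 0 <= 2 * C by have := C_gt0; lra.
    have := dom_dist dz dyk; have := dist_iter_x k dz; rewrite !enorm_le//.
    have := dot_ge0 (z - x k.+1); have := dot_ge0 (z - y k).
    move: l_bd => /andP[].
    set p := dot (z - y k) _; set q := dot (z - x k.+1) _; set r := l _.
    move=> r0 rL p0 q0 q1 p1.
    have : r * p <= L * p by exact: ler_wpM2r.
    have : 0 <= r * q by exact: mulr_ge0.
    have : L * p <= L * (2 * C) ^+ 2 by rewrite ler_pM2l.
    have : L * q <= L * (4 * C) ^+ 2 by rewrite ler_pM2l.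
    lra.
  exists 0; rewrite (l_cvx cvx); split; last by lra.
  by have := convex_linearization_le Omega_convex f_diff f_lip cvx Ox (dom_sub dz); lra.
apply: (accelerated_step (g := gradient f (x k.+1)) (fx := f (x k.+1)) (E := E)).
- exact: L_gt0.
- exact: l_bd.
- exact: iter_a_ge1.
- by move: err_y; rewrite enorm_sqr ler_norml /linearization => /andP[]; lra.
- exact: l_tangent.
- exact: Efz.
- exact: subgradient_fine.
- exact: subgradient_fine.
- exact: ED.
- exact: dist_fista_point.
Qed.

Lemma sum_residual_le K D :
  D = 10 * L * C ^+ 2 \/ convex_function Omega f /\ D = 0 ->
  \sum_(k < K.+1) a k ^+ 2 * residual k <= D * a K ^+ 2 + 8 * L * C ^+ 2.
Proof.
(* With the last iterate as comparison point, the final function gap is 0. *)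
move=> HD; set z := y K.+1; have dz : edom h z by exact: iter_y_dom.
have telescope J : a J ^+ 2 * (F (y J.+1) - F z)
    + \sum_(k < J.+1) a k ^+ 2 * residual k
    + 2 * L * dot (z - fista_point J.+1) (z - fista_point J.+1)
    <= D * a J ^+ 2 + 2 * L * dot (z - y0) (z - y0).
  elim: J => [|J IH].
    (* Since [a_0 = 1], the weight [a_0 (a_0 - 1)] of the initial gap vanishes. *)
    have := iterate_step 0 dz HD; rewrite big_ord_recr big_ord0 /= a_0; lra.
  have [_ aE] := a_rec J.
  have := iterate_step J.+1 dz HD; rewrite big_ord_recr /= aE.
  (* Hence the errors [a_k D] telescope to [D a_J^2] too. *)
  have -> : a J.+1 ^+ 2 = a J.+1 + a J ^+ 2 by rewrite -aE; ring.
  move: IH; rewrite /= ; lra.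
have := telescope K; rewrite subrr mulr0 add0r.
have := dot_ge0 (z - fista_point K.+1).
have C2 : 0 <= 2 * C by have := C_gt0; lra.
have := dom_dist dz y0_dom; rewrite enorm_le//.
set d := dot (z - y0) _; set e := dot (z - fista_point _) _ => d1 e0 H.
have : L * d <= L * (2 * C) ^+ 2 by rewrite ler_pM2l.
have : 0 <= L * e by rewrite mulr_ge0// ltW.
lra.
Qed.

Lemma enorm_v_le k : enorm (v k.+1) ^+ 2 <= 72 * L * residual k.
Proof.
case: run => _ _ _ _ /(_ k.+1 isT)[_ _ vE _ _].
rewrite -/x -/y -/v -/l /= in vE.
have [/andP[l0 lL] _ _] := iter_L_bounds k.
set d := y k.+1 - x k.+1; set e := y k.+1 - y k.
have vle : enorm (v k.+1) <= 6 * L * enorm d + l k.+1 * enorm e.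
  have -> : v k.+1 = (gradient f (y k.+1) - gradient f (x k.+1))
      + ((l k.+1 - 4 * L) *: d - l k.+1 *: e).
    by rewrite vE; apply/rowP => i; rewrite !mxE; ring.
  have := f_lip (dom_sub (iter_y_dom k.+1)) (iter_x_Omega k); rewrite -/d => glip.
  have := ler_enormD (gradient f (y k.+1) - gradient f (x k.+1))
      ((l k.+1 - 4 * L) *: d - l k.+1 *: e).
  have := ler_enormB ((l k.+1 - 4 * L) *: d) (l k.+1 *: e).
  rewrite !enormZ (ger0_norm l0).
  have : `|l k.+1 - 4 * L| * enorm d <= 5 * L * enorm d.
    by rewrite ler_wpM2r ?enorm_ge0// ler_norml; have := L_gt0; lra.
  lra.
have r0 : 0 <= 6 * L * enorm d + l k.+1 * enorm e.
  by rewrite addr_ge0// mulr_ge0 ?enorm_ge0// mulr_ge0// ltW.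
have : enorm (v k.+1) ^+ 2 <= (6 * L * enorm d + l k.+1 * enorm e) ^+ 2.
  by rewrite ler_pXn2r// nnegrE enorm_ge0.
rewrite /residual -/d -/e -!enorm_sqr.
move: (enorm d) (enorm e) => p q H.
(* The square of a sum is at most twice the sum of the squares; this is where [72 = 2 * 6^2] comes
   from. *)
have : 0 <= (6 * L * p - l k.+1 * q) ^+ 2 by exact: sqr_ge0.
have : l k.+1 * (l k.+1 * q ^+ 2) <= L * (l k.+1 * q ^+ 2).
  by rewrite ler_wpM2r// mulr_ge0// sqr_ge0.
have := mulr_ge0 (ltW L_gt0) (mulr_ge0 l0 (sqr_ge0 q)).
lra.
Qed.

(** The factor 12 comes from the cubic lower bound on the sum of the [a_k ^+ 2], and [72 L] from the
    bound on [v_k]. *)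
Lemma nonterminated_bound K D eps : 0 < eps ->
  D = 10 * L * C ^+ 2 \/ convex_function Omega f /\ D = 0 ->
  (forall k, (0 < k <= K.+1)%N -> eps < enorm (v k)) ->
  eps ^+ 2 * K.+1%:R ^+ 3 <= 12 * (72 * L) * (D * K.+1%:R ^+ 2 + 8 * L * C ^+ 2).
Proof.
move=> eps0 HD Hv.
have D0 : 0 <= D.
  case: HD => [->|[_ ->//]].
  by rewrite mulr_ge0 ?sqr_ge0// mulr_ge0// ltW.
have cube : K.+1%:R ^+ 3 / 12 <= \sum_(k < K.+1) a k ^+ 2.
  apply: sum_sqr_ge_cube => k; have /andP[+ _] := iter_a_bounds k.
  by apply: le_trans; rewrite ler_pM2r ?invr_gt0// ler_nat.
have Hs : eps ^+ 2 * \sum_(k < K.+1) a k ^+ 2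
    <= 72 * L * \sum_(k < K.+1) a k ^+ 2 * residual k.
  rewrite !mulr_sumr; apply: ler_sum => k _.
  have vk : eps ^+ 2 <= enorm (v k.+1) ^+ 2.
    have := Hv k.+1 (ltn_ord k) => /ltW.
    by rewrite ler_pXn2r// nnegrE ?enorm_ge0// ltW.
  rewrite mulrC [leRHS]mulrCA; apply: ler_wpM2l; first exact: sqr_ge0.
  exact: le_trans vk (enorm_v_le k).
have /andP[_ aK] := iter_a_bounds K.
have aK2 : D * a K ^+ 2 <= D * K.+1%:R ^+ 2.
  rewrite ler_wpM2l// ler_pXn2r ?nnegrE//.
  exact: le_trans ler01 (iter_a_ge1 K).
have L72 : 0 <= 72 * L by rewrite mulr_ge0// ltW.
have H1 := ler_wpM2l L72 (sum_residual_le K HD).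
have H2 := ler_wpM2l L72 aK2.
have H3 := ler_wpM2l (sqr_ge0 eps) cube.
lra.
Qed.

Lemma iter_approx_solution k eps : enorm (v k.+1) <= eps ->
  approx_solution f h eps (y k.+1) (v k.+1).
Proof.
split=> //; exists (v k.+1 - gradient f (y k.+1)); first exact: iter_v_subgradient.
by rewrite addrC subrK.
Qed.

End Iterates.

(** * Existence of the iterates and complexity *)

Lemma extrapolation_exists (R : rcfType) (b : R) :
  exists a, 0 < a /\ a * (a - 1) = b ^+ 2.
Proof.
have p : 0 <= 1 + 4 * b ^+ 2 by have := sqr_ge0 b; lra.
exists ((1 + Num.sqrt (1 + 4 * b ^+ 2)) / 2).
have := sqrtr_ge0 (1 + 4 * b ^+ 2); have := sqr_sqrtr p.
by move: (Num.sqrt _) => s sE s0; split; [|apply: (@mulfI _ 4)]; lra.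
Qed.

Lemma linearization_continuous (R : realType) (n : nat) (f : 'rV[R]_n -> R) x :
  continuous (fun z => linearization f z x).
Proof.
move=> z.
have -> : (fun z => linearization f z x) =
    (fun z => (f x - dot (gradient f x) x) + dot (gradient f x) z).
  by apply/funext => u; rewrite /linearization dotDr dotNr; ring.
set c := f x - _.
have cc : {for z, continuous (fun=> c : R)} by exact: cst_continuous.
exact: (continuousD cc (@dot_continuous _ _ _ z)).
Qed.

(** Once minimizers, projections and roots are selected by choice, a run is the orbit of a map on
    states. *)
Lemma mFISTA_run_exists (R : realType) (n : nat) (Omega : set 'rV[R]_n)
    (f : 'rV[R]_n -> R) (h : 'rV[R]_n -> \bar R) (L : R) (y0 : 'rV[R]_n) :
  closed Omega -> Omega !=set0 -> proper_efun h -> lower_semicontinuous h ->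
  closed (edom h) -> bounded_set (edom h) ->
  exists S : iterates R n, mFISTA_run f h Omega L y0 S.
Proof.
move=> Ocl O0 hp hl hcl hbd.
pose fk (l : R) (p z : 'rV[R]_n) := f z + l / 2 * enorm (z - p) ^+ 2.
have Yex (t : 'rV[R]_n * 'rV[R]_n * R) : exists q, q \in argmin (fun z =>
    (linearization (fk t.2 t.1.2) z t.1.1)%:E + h z
      + (2 * L * enorm (z - t.1.1) ^+ 2)%:E)%E.
  have [|q] := @argmin_exists _ _ h (fun z => linearization (fk t.2 t.1.2) z t.1.1
      + 2 * L * enorm (z - t.1.1) ^+ 2) hp hl hcl hbd.
    move=> z.
    have cl : {for z, continuous (fun z => linearization (fk t.2 t.1.2) z t.1.1)}.
      exact: linearization_continuous.
    have cc : {for z, continuous (fun=> 2 * L : R)} by exact: cst_continuous.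
    have cq := continuousM cc (@sqdist_continuous _ _ t.1.1 z).
    exact: (continuousD cl cq).
  move=> Hq; exists q; move: Hq; congr (is_true (q \in argmin _)).
  by apply/funext => z; rewrite EFinD addeA [(h z + _)%E]addeC.
have [Y HY] := choice Yex.
have [P HP] := choice (fun x => projection_exists x Ocl O0).
have [N HN] := choice (@extrapolation_exists R).
pose Ak (x y : 'rV[R]_n) := if y == x then 0 else
  2 * (linearization f y x - f y) / enorm (y - x) ^+ 2.
(* State [k] holds [x_(k+1)], [y_k], [a_k], [L_(k+1)]; hence the [k.-1] when the sequences are read
   off. *)
pose state : Type := 'rV[R]_n * 'rV[R]_n * R * R.
pose next (s : state) : state := let: (x, p, b, l) := s in
  let q := Y (x, p, l) in
  let a := N b in
  let x' := P (q + ((b - 1) / a) *: (q - p)) in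
  (x', q, a, Num.max 0 (Ak x' q)).
pose st k : state := iter k next (y0, y0, 1, 0).
pose X k := (st k).1.1.1.
pose Q k := (st k).1.1.2.
pose B k := (st k).1.2.
pose l k := (st k).2.
have stE k : st k.+1 = next (X k, Q k, B k, l k).
  by rewrite /X /Q /B /l -!surjective_pairing.
have QE k : Q k.+1 = Y (X k, Q k, l k) by rewrite /Q stE.
have BE k : B k.+1 = N (B k) by rewrite /B stE.
have XE k : X k.+1 = P (Q k.+1 + ((B k - 1) / B k.+1) *: (Q k.+1 - Q k)).
  by rewrite BE QE /X stE.
have lE k : l k.+1 = Num.max 0 (Ak (X k.+1) (Q k.+1)).
  by rewrite XE BE QE /l stE.
exists (Iterates (fun k => X k.-1) Q
  (fun k => gradient f (Q k) - gradient f (X k.-1)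
    + l k.-1 *: (Q k.-1 - X k.-1) + (4 * L) *: (X k.-1 - Q k))
  B (fun k => l k.-1) (fun k => Ak (X k) (Q k))).
split => //= -[//|k] _ /=; split => //.
- by rewrite QE; exact: HY (X k, Q k, l k).
- by rewrite BE; exact: HN.
- by rewrite XE; exact: HP.
Qed.

Lemma mFISTA_complexity_of_bound (R : realType) (n : nat) (Omega : set 'rV[R]_n)
    (f : 'rV[R]_n -> R) (h : 'rV[R]_n -> \bar R) (L M p : R) (y0 : 'rV[R]_n) :
  0 <= M -> 0 <= p ->
  (forall S, mFISTA_run f h Omega L y0 S -> forall k eps,
     enorm (iter_v S k.+1) <= eps ->
     approx_solution f h eps (iter_y S k.+1) (iter_v S k.+1)) ->
  (forall S, mFISTA_run f h Omega L y0 S -> forall eps K, 0 < eps ->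
     (forall k, (0 < k <= K.+1)%N -> eps < enorm (iter_v S k)) ->
     K.+1%:R <= M * eps `^ (- p)) ->
  mFISTA_complexity f h Omega L y0 p.
Proof.
move=> M0 p0 approx bound eps0 eps0_gt0.
(* The extra [eps0 ^ p] pays for the stopping iteration itself, as [1 <= eps0 ^ p * eps ^ (- p)]. *)
exists (M + eps0 `^ p); first by rewrite ltr_wpDl// powR_gt0.
move=> eps /andP[eps_gt0 eps_le] S run.
have {}bound K : (forall k, (0 < k <= K)%N -> eps < enorm (iter_v S k)) ->
    K%:R <= M * eps `^ (- p).
  by case: K => [|K]; [rewrite mulr_ge0// powR_ge0|exact: bound].
pose stop k := (0 < k)%N && (enorm (iter_v S k) <= eps).
have ex_stop : exists k, stop k.
  (* Without a stop, the bound would hold for all [K], against the Archimedean property. *)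
  apply: contrapT => nstop.
  have := archi_boundP (mulr_ge0 M0 (powR_ge0 eps (- p))).
  apply/negP; rewrite -leNgt; apply: bound => k /andP[k0 _].
  by rewrite ltNge; apply/negP => vk; apply: nstop; exists k; apply/andP.
case: (ex_minnP ex_stop) => -[//|N] /andP[_ vN] Nmin; exists N.+1.
have before k : (0 < k < N.+1)%N -> eps < enorm (iter_v S k).
  move=> /andP[k0 kN]; rewrite ltNge; apply/negP => vk.
  have /Nmin : stop k by apply/andP.
  by rewrite leqNgt kN.
split; [by []|exact: approx|].
rewrite -natr1 mulrDl; apply: lerD.
  by apply: bound => k /andP[k0 kN]; apply: before; rewrite k0 ltnS.
rewrite powRN ler_pdivlMr ?powR_gt0// mul1r.
by apply: ge0_ler_powR => //; rewrite nnegrE ltW.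
Qed.

Theorem theorem4p2 (R : realType) (n : nat) (Omega : set 'rV[R]_n)
    (f : 'rV[R]_n -> R) (h : 'rV[R]_n -> \bar R) (L C : R) (y0 : 'rV[R]_n)
    (Omega_closed : closed Omega)
    (Omega_convex : convex_set Omega)
    (L_gt0 : 0 < L)
    (f_diff : forall u, Omega u -> differentiable f u)
    (f_lip : forall u1 u2, Omega u1 -> Omega u2 ->
       enorm (gradient f u1 - gradient f u2) <= L * enorm (u1 - u2))
    (h_proper : proper_efun h)
    (h_lsc : lower_semicontinuous h)
    (h_convex : convex_efun h)
    (dom_closed : closed (edom h))
    (dom_bounded : bounded_set (edom h))
    (dom_sub : edom h `<=` Omega)
    (C_gt0 : 0 < C)
    (dom_le : forall y, edom h y -> enorm y <= C)
    (y0_dom : edom h y0) :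
  [/\ exists S : iterates R n, mFISTA_run f h Omega L y0 S,
      mFISTA_complexity f h Omega L y0 2 &
      convex_function Omega f -> mFISTA_complexity f h Omega L y0 (2 / 3)].
Proof.
have approx S : mFISTA_run f h Omega L y0 S -> forall k eps,
     enorm (iter_v S k.+1) <= eps ->
     approx_solution f h eps (iter_y S k.+1) (iter_v S k.+1).
  move=> run k eps.
  exact: (iter_approx_solution f_diff h_proper h_convex dom_sub y0_dom run).
have [c [c_gt0 bound]] : exists c, 0 < c /\
    forall S (run : mFISTA_run f h Omega L y0 S) K D eps, 0 < eps ->
      D = 10 * L * C ^+ 2 \/ convex_function Omega f /\ D = 0 ->
      (forall k, (0 < k <= K.+1)%N -> eps < enorm (iter_v S k)) ->
      eps ^+ 2 * K.+1%:R ^+ 3 <= c * (D * K.+1%:R ^+ 2 + 8 * L * C ^+ 2).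
  exists (12 * (72 * L)); split; first by rewrite !mulr_gt0.
  move=> S run K D eps.
  exact: (nonterminated_bound Omega_convex L_gt0 f_diff f_lip h_proper h_convex
    dom_sub C_gt0 dom_le y0_dom run).
have : 0 < 8 * L * C ^+ 2 by rewrite mulr_gt0 ?exprn_gt0// mulr_gt0.
move: (8 * L * C ^+ 2) bound => E bound E_gt0.
split.
- by apply: mFISTA_run_exists => //; exists y0; exact: dom_sub.
- have : 0 < 10 * L * C ^+ 2 by rewrite mulr_gt0 ?exprn_gt0// mulr_gt0.
  have {}bound S run K eps eps_gt0 nstop :=
    bound S run K _ eps eps_gt0 (or_introl erefl) nstop.
  move: (10 * L * C ^+ 2) bound => D bound D_gt0.
  (* As [k >= 1], [E <= E k^2]; dividing the bound by [k^2] leaves [eps^2 k <= c (D + E)]. *)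
  have cDE : 0 < c * (D + E) by rewrite mulr_gt0// addr_gt0.
  apply: (mFISTA_complexity_of_bound (ltW cDE)) => // S run eps K eps_gt0 nstop.
  have := bound S run K eps eps_gt0 nstop.
  rewrite (powR_invn 2 (ltW eps_gt0)) ler_pdivlMr ?exprn_gt0//.
  have k1 : 1 <= K.+1%:R :> R by rewrite ler1n.
  move: (K.+1%:R) k1 => k k1 H.
  have k2 : 0 < k ^+ 2 by rewrite exprn_gt0// (lt_le_trans ltr01).
  rewrite -(ler_pM2r k2) mulrC mulrA -exprSr mulrC (le_trans H)//.
  rewrite -mulrA ler_pM2l// mulrDl lerD2l ler_peMr ?(ltW E_gt0)//.
  by rewrite exprn_ege1.
- move=> cvx.
  (* With [D = 0] the bound reads [eps^2 k^3 <= c E]; cube roots give the constant and the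
     exponent. *)
  have cE : 0 <= c * E by rewrite mulr_ge0// ltW.
  apply: (mFISTA_complexity_of_bound (powR_ge0 (c * E) 3^-1)) => //.
  move=> S run eps K eps_gt0 nstop.
  have := bound S run K 0 eps eps_gt0 (or_intror (conj cvx erefl)) nstop.
  rewrite mul0r add0r mulrC -ler_pdivlMr ?exprn_gt0// => cube.
  have -> : K.+1%:R = (K.+1%:R ^+ 3) `^ 3^-1 :> R.
    by rewrite -powR_mulrn// -powRrM divff// powRr1.
  have -> : (c * E) `^ 3^-1 * eps `^ (- (2 / 3)) = (c * E / eps ^+ 2) `^ 3^-1.
    rewrite [RHS]powRM// ?invr_ge0 ?sqr_ge0// -(powR_invn 2 (ltW eps_gt0)) -powRrM.
    by rewrite mulNr.
  by apply: ge0_ler_powR => //; rewrite nnegrE ?exprn_ge0// divr_ge0// sqr_ge0.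
Qed.
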